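(* Consider the difference equation $$x_{n+1}=1-\frac{1}{2}|x_n|+\frac{1}{2}x_{n-1},\qquad n\geq 0,$$ with arbitrary real initial conditions $(x_{-1},x_0)$. Then: (a) $\bar{x}=1$ is an equilibrium point. (b) For all real $x,y$ with $0\leq x,y\leq 2$ and $x+y=2$, the sequence $(x,y,x,y,\ldots)$ is a $2$-periodic solution (so that there is a continuum of $2$-periodic sequences). (c) Every other solution converges to one of the $2$-periodic solutions $(x,y,x,y,\ldots)$ described in (b).
   Context: An equilibrium point is a value $\bar{x}$ such that the constant sequence $\bar{x}$ is a solution. The period $2$ is not required to be minimal: the choice $x=y=1$ in (b) gives the constant solution. A solution $(x_n)_{n\geq -1}$ converges to a $2$-periodic sequence $(p_n)_{n\geq -1}$ if $x_n-p_n\to 0$ as $n\to+\infty$. *)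

(* Defs.v *)
From HB Require Import structures.
From mathcomp Require Import all_boot all_order all_algebra.
From mathcomp Require Import all_classical all_reals all_analysis.

Set Implicit Arguments.
Unset Strict Implicit.
Unset Printing Implicit Defensive.

Import Order.TTheory GRing.Theory Num.Theory.
Import numFieldNormedType.Exports.

Local Open Scope classical_set_scope.
Local Open Scope ring_scope.

(** A sequence (x_n) indexed by n >= -1 is encoded as [u : nat -> R] with
    [u k = x_(k-1)]: [u 0] and [u 1] are the initial conditions x_(-1), x_0. *)

Definition is_solution (R : realType) (u : nat -> R) : Prop :=
  forall n : nat, u n.+2 = 1 - 2^-1 * `|u n.+1| + 2^-1 * u n.

Definition is_equilibrium (R : realType) (c : R) : Prop :=
  is_solution (fun _ : nat => c).

(** The period 2 need not be minimal. *)
Definition two_periodic (R : realType) (u : nat -> R) : Prop :=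
  forall n : nat, u n.+2 = u n.

(** (x, y, x, y, ...), starting with x at index -1. *)
Definition alternating_seq (R : realType) (x y : R) : nat -> R :=
  fun n : nat => if odd n then y else x.

Definition alternating_family (R : realType) : set (nat -> R) :=
  [set p | exists x y : R,
     [/\ 0 <= x <= 2, 0 <= y <= 2, x + y = 2 & p = alternating_seq x y]].
Arguments alternating_family R _ : clear implicits.

Definition converges_to_sequence (R : realType) (u p : nat -> R) : Prop :=
  (fun n : nat => u n - p n) @ \oo --> (0 : R).

(* Main.v *)
(** Let [e_n = x_n - 1].  The recurrence gives
    [2 |e_(n+2)| <= |e_(n+1)| + |e_n|], which forces [|e_n|] to converge to some
    [E].  If [E > 0], then far along the sequence [e_n] is close to [E] or to
    [-E]; inserting the possible signs of [e_n, e_(n+1), e_(n+2)] in the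
    recurrence shows that [E <= 1] and that consecutive signs are opposite, so
    that [x_n] approaches [1 + E, 1 - E, 1 + E, ...] up to a shift. *)
Require Import Defs.
From mathcomp Require Import all_boot all_order all_algebra.
From mathcomp Require Import all_classical all_reals all_analysis.
From mathcomp Require Import lra.

Import Order.TTheory GRing.Theory Num.Theory.
Import numFieldNormedType.Exports.

Local Open Scope classical_set_scope.
Local Open Scope ring_scope.

(** Each new term is at most the mean of the two before it, so the larger of two consecutive terms
    never increases; its infimum is the limit. *)
Lemma cvg_of_mean_bound (R : realType) (a : nat -> R) :
  (forall n, 0 <= a n) -> (forall n, 2 * a n.+2 <= a n.+1 + a n) ->
  exists2 E : R, 0 <= E & a @ \oo --> E.
Proof.
move=> a0 ha.
pose m n := Num.max (a n.+1) (a n).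
have m0 n : 0 <= m n by rewrite le_max a0.
have m_dec n : m n.+1 <= m n.
  have := ha n; rewrite /m ge_max.
  by case: (leP (a n.+1) (a n)) => ? ?; apply/andP; split; lra.
have m_noninc n k : m (n + k)%N <= m n.
  by elim: k => [|k IH]; rewrite ?addn0// addnS; exact: le_trans IH.
have hinf : has_inf (range m).
  by split; [exists (m 0%N), 0%N | exists 0 => _ [n _ <-]].
pose M := inf (range m).
have Mm n : M <= m n by apply: ge_inf; [exact: hinf.2 | exists n].
exists M; first by apply: lb_le_inf; [exact: hinf.1 | move=> _ [n _ <-]].
apply/cvgrPdist_le => e e0.
(* With this slack, [a n < M - e] gives [a n.+2 < M - e / 3], which offsets [a n.+1 < M + e / 3] in
   the bound on [a n.+3]. *)
have d0 : 0 < e / 3 by lra.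
have [_ [N _ <-] mN] := inf_adherent d0 hinf.
have up n : (N <= n)%N -> a n < M + e / 3.
  move=> /subnKC <-; apply: (@le_lt_trans _ _ (m N)); last exact: mN.
  by apply: le_trans (m_noninc N (n - N)%N); rewrite le_max lexx orbT.
exists N => // n /= Nn.
(* If [a n < M - e], then [a n.+2] and [a n.+3] are both below [M]. *)
rewrite ler_norml; apply/andP; split; first by have := up n Nn; lra.
rewrite leNgt; apply/negP => lt_an.
have := Mm n.+2; rewrite le_max.
have := up n.+1 (leqW Nn); have := ha n; have := ha n.+1.
by move=> h1 h2 h3 /orP[] h4; lra.
Qed.

Lemma alternating_seqP (R : realType) (E : R) : -1 <= E <= 1 ->
  alternating_family R (alternating_seq (1 + E) (1 - E)).
Proof. by move=> /andP[? ?]; exists (1 + E), (1 - E); split => //; lra. Qed.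

Lemma alternating_seq_is_solution (R : realType) (x y : R) :
  0 <= x -> 0 <= y -> x + y = 2 -> is_solution (alternating_seq x y).
Proof.
move=> x0 y0 xy n; rewrite /alternating_seq /= negbK.
by case: (odd n) => /=; rewrite ger0_norm//; lra.
Qed.

Lemma two_periodic_alternating_seq (R : realType) (x y : R) :
  two_periodic (alternating_seq x y).
Proof. by move=> n; rewrite /alternating_seq /= negbK. Qed.

(** Cantor-Bernstein: the family lies in the image of a line, and [contract] injects the line into
    [[-1, 1]], hence into the family. *)
Lemma card_alternating_family (R : realType) :
  (alternating_family R #= [set: R])%card.
Proof.
rewrite card_eq_le; apply/andP; split.
  pose f (x : R) := alternating_seq x (2 - x).
  apply: (card_le_trans _ (card_image_le f setT)); apply: subset_card_le.
  move=> _ [x [y [_ _ xy ->]]]; exists x => //.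
  by rewrite /f; congr alternating_seq; lra.
pose f (t : R) := alternating_seq (1 + contract t%:E) (1 - contract t%:E).
have f_inj : set_inj setT f.
  move=> s t _ _ /(congr1 (fun u : nat -> R => u 0%N)) /addrI.
  by move=> /(can_inj (@contractK R)) [].
have := inj_card_eq f_inj; rewrite card_eq_le => /andP[_].
move=> /card_le_trans; apply; apply: subset_card_le => _ [t _ <-].
by apply: alternating_seqP; rewrite -ler_norml contract_le1.
Qed.

Section Solution.
Context {R : realType} {u : nat -> R} (hu : is_solution u).

(** Here [2 e_(n+2) = e_n + (1 - |1 + e_(n+1)|)], and the bracket is at most [|e_(n+1)|] in absolute
    value. *)
Lemma solution_mean_bound n :
  2 * `|u n.+2 - 1| <= `|u n.+1 - 1| + `|u n - 1|.
Proof.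
rewrite hu; case: (ger0P (u n.+1)) => ?; case: (ger0P (u n.+1 - 1)) => ?;
  case: (ger0P (u n - 1)) => ?;
  by rewrite -ler_pdivlMl// ler_norml; apply/andP; split; lra.
Qed.

Lemma solution_near_le1 (E : R) :
  `|u n - 1| @[n --> \oo] --> E -> E <= 1.
Proof.
move=> /cvgrPdist_le uE; rewrite leNgt; apply/negP => E1.
(* If [e_(n+1)] is near [- E], then [|e_(n+2)|] is near [1] or [E - 1], at distance [E - 1] or [1]
   from [E]; hence the two bounds on [e]. *)
have [e [e0 eE e1]] : exists e : R, [/\ 0 < e, e <= (E - 1) / 10 & e <= 1 / 10].
  exists (Num.min ((E - 1) / 10) (1 / 10)).
  by rewrite lt_min !ge_min !lexx orbT; split=> //; lra.
have [N _ hN] := uE _ e0.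
(* If [E > 1] no deviation [u n - 1] could be negative, nor could three
   consecutive ones be nonnegative. *)
have ge0 n : (N <= n)%N -> 0 <= u n.+1 - 1.
  move=> Nn; rewrite leNgt; apply/negP => lt0.
  have := hN n Nn; have := hN n.+1 (leqW Nn).
  have := hN n.+2 (leqW (leqW Nn)) => /=; rewrite !ler_norml; have := hu n.
  case: (ger0P (u n.+1)) => ?; case: (ger0P (u n.+1 - 1)) => ?;
  case: (ger0P (u n - 1)) => ?; case: (ger0P (u n.+2 - 1)) => ?;
  by move=> ? /andP[? ?] /andP[? ?] /andP[? ?]; lra.
have N1 := leqW (leqnn N); have N2 := leqW N1; have N3 := leqW N2.
have := ge0 N (leqnn N); have := ge0 _ N1; have := ge0 _ N2.
have := hN _ N1; have := hN _ N2; have := hN _ N3 => /= + + + h3 h2 h1.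
rewrite (ger0_norm h1) (ger0_norm h2) (ger0_norm h3) !ler_norml.
have := hu N.+1; rewrite ger0_norm; last by lra.
by move=> ? /andP[? ?] /andP[? ?] /andP[? ?]; lra.
Qed.

(** Since [E <= 1], eventually [u n.+1 >= - E / 10], so [2 e_(n+2)] is within [E / 5] of
    [e_n - e_(n+1)]. Equal signs would make this difference small too, and [|e_(n+2)|] could not be
    near [E]. *)
Lemma solution_eventually_alternates (E : R) :
  0 < E -> `|u n - 1| @[n --> \oo] --> E ->
  exists N, forall n, (N <= n)%N -> (0 <= u n.+1 - 1) = ~~ (0 <= u n - 1).
Proof.
move=> E0 uE; have E1 := solution_near_le1 _ uE.
move/cvgrPdist_le: uE => uE.
have d0 : 0 < E / 10 by lra.
have [N _ hN] := uE _ d0.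
exists N => n Nn.
have := hN n Nn; have := hN n.+1 (leqW Nn).
have := hN n.+2 (leqW (leqW Nn)) => /=; rewrite !ler_norml; have := hu n.
case: (ger0P (u n.+1)) => ?; case: (ger0P (u n.+1 - 1)) => ?;
case: (ger0P (u n - 1)) => //= ?; case: (ger0P (u n.+2 - 1)) => ?;
by move=> ? /andP[? ?] /andP[? ?] /andP[? ?]; lra.
Qed.

Lemma solution_cvg : exists2 p : nat -> R,
  alternating_family R p & converges_to_sequence u p.
Proof.
have [E E0 uE] := cvg_of_mean_bound _ _ (fun n => normr_ge0 (u n - 1))
  solution_mean_bound.
have E1 := solution_near_le1 _ uE.
(* [F] is [E] or [- E] according to the phase; once the signs match, the two errors agree
   exactly. *)
suff [F [/eqP FE [N hN]]] : exists F : R, `|F| == E /\ exists N, forall n,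
    (N <= n)%N -> `|u n - alternating_seq (1 + F) (1 - F) n|
                  = `|E - `|u n - 1| |.
  exists (alternating_seq (1 + F) (1 - F)).
    by apply: alternating_seqP; rewrite -ler_norml FE.
  apply/cvgrPdist_le => e e0; move/cvgrPdist_le: uE => /(_ e e0)[N' _ hN'].
  exists (maxn N N') => // n /=; rewrite geq_max => /andP[? ?].
  by rewrite sub0r normrN hN//; exact: hN'.
have [E_gt0|] := ltP 0 E; last first.
  move=> E_le0; have {E_le0} -> : E = 0 by apply/eqP; rewrite eq_le E_le0.
  exists 0; rewrite normr0; split=> //; exists 0%N => n _.
  by rewrite sub0r normrN normr_id /alternating_seq subr0 addr0 if_same.
have [N alt] := solution_eventually_alternates _ E_gt0 uE.
(* [s] holds when, from [N] on, the nonnegative deviations sit at even indices. *)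
pose s := odd N (+) (0 <= u N - 1).
have sgn k : (0 <= u (N + k)%N - 1) = s (+) odd (N + k).
  elim: k => [|k IH]; first by rewrite addn0 /s addbAC addbb.
  by rewrite addnS alt ?leq_addr// IH /= addbN.
exists (if s then E else - E); split.
  by case: s {sgn}; rewrite ?normrN ger0_norm.
exists N => n /subnKC Nn; have := sgn (n - N)%N; rewrite {}Nn /alternating_seq.
case: s {sgn}; case: (odd n) => /=; case: (ger0P (u n - 1)) => //= _ _;
  first [congr `|_|; lra | rewrite distrC; congr `|_|; lra].
Qed.

End Solution.

Theorem theorem2 (R : realType) :
  [/\ is_equilibrium (1 : R),
      (forall x y : R, 0 <= x <= 2 -> 0 <= y <= 2 -> x + y = 2 ->
         is_solution (alternating_seq x y) /\ two_periodic (alternating_seq x y)),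
      (alternating_family R #= [set: R])%card
    & forall u : nat -> R, is_solution u -> ~ alternating_family R u ->
        exists2 p : nat -> R,
          alternating_family R p & converges_to_sequence u p].
Proof.
split.
- by move=> n; rewrite normr1; lra.
- move=> x y /andP[x0 _] /andP[y0 _] xy; split.
    exact: alternating_seq_is_solution.
  exact: two_periodic_alternating_seq.
- exact: card_alternating_family.
- by move=> u hu _; exact: solution_cvg hu.
Qed.
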